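(* Let $A\in\mathcal{M}_n$. Then $A$ is in additive finite free position with itself if and only if it is the sum of a nilpotent and a scalar matrix, i.e., the multiple of a unipotent matrix.
   Context: $\mathcal{M}_n=\mathbb{C}^{n\times n}$ is the set of $n\times n$ complex matrices and $\chi_A(x)=\det(xI-A)$. A scalar matrix is a matrix $\lambda I$ with $\lambda\in\mathbb{C}$; a unipotent matrix is a matrix of the form $I+N$ with $N$ nilpotent. For polynomials $p(x)=\sum_{k=0}^n a_kx^{n-k}$ and $q(x)=\sum_{k=0}^n b_kx^{n-k}$ of degree $n$ over $\mathbb{C}$, the additive convolution is $p(x)\boxplus q(x)=\sum_{k=0}^n\Big(\sum_{i+j=k}\frac{\binom{n-i}{j}}{\binom{n}{j}}a_ib_j\Big)x^{n-k}$. Matrices $A,B\in\mathcal{M}_n$ are in additive finite free position if $\chi_{A+B}(x)=\chi_A(x)\boxplus\chi_B(x)$; thus $A$ is in additive finite free position with itself if $\chi_{2A}(x)=\chi_A(x)\boxplus\chi_A(x)$.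
   Formalization: The gloss ''i.e., the multiple of a unipotent matrix'' fails for nonzero nilpotent matrices (e.g. E_12 for n = 2); it is replaced by ''nilpotent or the multiple of a unipotent matrix''. *)

(* Defs.v *)
From HB Require Import structures.
From mathcomp Require Import all_boot all_order all_algebra.
From mathcomp Require Import reals.
From mathcomp Require Import complex.

Set Implicit Arguments.
Unset Strict Implicit.
Unset Printing Implicit Defensive.

Import GRing.Theory.
Local Open Scope ring_scope.

(* Polynomials are written in descending order p = \sum_k a_k 'X^(n - k), so
   a_k is p`_(n - k). The degree n is an explicit argument, since the formula
   depends on it; it is only meaningful for p and q of degree n. *)
Definition additive_convolution (F : fieldType) (n : nat) (p q : {poly F}) :
    {poly F} :=
  \sum_(k < n.+1)
    (\sum_(i < n.+1) \sum_(j < n.+1 | (i + j)%N == k)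
        'C(n - i, j)%:R / 'C(n, j)%:R * p`_(n - i) * q`_(n - j)) *: 'X^(n - k).

Definition additive_finite_free_position (F : fieldType) (n : nat)
    (A B : 'M[F]_n) : Prop :=
  char_poly (A + B) = additive_convolution n (char_poly A) (char_poly B).

Definition nilpotent_mx (F : fieldType) (n : nat) (N : 'M[F]_n) : Prop :=
  exists m : nat, N ^+ m = 0.

Definition unipotent_mx (F : fieldType) (n : nat) (U : 'M[F]_n) : Prop :=
  exists2 N : 'M[F]_n, nilpotent_mx N & U = 1%:M + N.

(* Main.v *)
Require Import Defs.
From HB Require Import structures.
From mathcomp Require Import all_boot all_order all_algebra.
From mathcomp Require Import reals.
From mathcomp Require Import complex.
From mathcomp Require Import ring.

Set Implicit Arguments.
Unset Strict Implicit.
Unset Printing Implicit Defensive.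

Import GRing.Theory.
Local Open Scope ring_scope.

(** Write a polynomial of degree n as a sum of alpha_k 'C(n, k) 'X^(n - k), and
    attach to it the truncated exponential generating function alpha(t), the sum
    of alpha_k t^k / k! for k <= n. In these coordinates the additive convolution
    is multiplication: 'C(n - i, j) 'C(n, i) = 'C(n, i + j) 'C(i + j, i) turns the
    weights of the convolution into plain binomial coefficients, so p \boxplus q
    has generating function alpha_p(t) alpha_q(t) modulo t^(n+1)
    ([binomial_coef_additive_convolution]). Dilating a matrix by c dilates the
    generating function of its characteristic polynomial to alpha(c t)
    ([binomial_coef_char_poly_scale]).

    Hence A is in free position with itself iff alpha(2 t) = alpha(t)^2 modulo
    t^(n+1), where alpha_0 = 1. The logarithm of alpha is then fixed by
    L(2 t) = 2 L(t), so it is linear and alpha is an exponential: alpha_k = a^k.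
    Instead of taking logarithms, [geometric_of_binomial_square] reads the same
    rigidity off the coefficients by induction on k: alpha_k for k >= 2 is
    determined by the previous ones because 2^k <> 2. Geometric coordinates are
    exactly those of ('X - c)^n with c = - a.

    It remains that the characteristic polynomial is ('X - c)^n iff A - c is
    nilpotent. One direction is the Cayley-Hamilton theorem. For the other, if
    N^m = 0 then 'X - c - N divides ('X - c)^m in the ring of polynomial matrices;
    taking determinants, char_poly (N + c) is a monic divisor of a power of
    'X - c. This uses no splitting of polynomials, so the whole argument holds
    over any numeric field. *)

(** The coordinates alpha_k in which additive convolution becomes the product of
    exponential generating functions; meaningful for k <= n and deg p <= n. *)
Definition binomial_coef (F : fieldType) (n : nat) (p : {poly F}) (k : nat) : F :=
  p`_(n - k) / 'C(n, k)%:R.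

Lemma bin_natr_neq0 (F : numFieldType) (n k : nat) :
  (k <= n)%N -> 'C(n, k)%:R != 0 :> F.
Proof. by move=> le_kn; rewrite Num.Theory.pnatr_eq0 -lt0n bin_gt0. Qed.

(** Both sides are the multinomial coefficient n! / (i! j! (n - i - j)!). *)
Lemma mul_bin_trinomial (n i j : nat) :
  (i + j <= n)%N ->
  ('C(n - i, j) * 'C(n, i) = 'C(n, i + j) * 'C(i + j, i))%N.
Proof.
move=> le_ijn.
have le_in : (i <= n)%N by apply: leq_trans le_ijn; apply: leq_addr.
have le_j : (j <= n - i)%N by rewrite leq_subRL.
apply/eqP.
have pos : (0 < i`! * (j`! * (n - (i + j))`!))%N by rewrite !muln_gt0 !fact_gt0.
rewrite -(eqn_pmul2r pos); apply/eqP; transitivity n`!.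
  by rewrite -(bin_fact le_in) -(bin_fact le_j) subnDA; ring.
by rewrite -(bin_fact le_ijn) -(bin_fact (leq_addr j i)) addKn; ring.
Qed.

(** The constraint i + j = k leaves one free index, which is at most k. *)
Lemma coef_additive_convolution (F : fieldType) (n k : nat) (p q : {poly F}) :
  (k <= n)%N ->
  (additive_convolution n p q)`_(n - k) =
  \sum_(i < k.+1)
    'C(n - i, k - i)%:R / 'C(n, k - i)%:R * p`_(n - i) * q`_(n - (k - i)).
Proof.
move=> le_kn; rewrite /additive_convolution coef_sum.
have lt_kn : (k < n.+1)%N by [].
rewrite (bigD1 (Ordinal lt_kn)) //= [X in _ + X]big1 ?addr0; last first.
  move=> l neq_lk; rewrite coefZ coefXn.
  case: eqP => [eq_sub|]; last by rewrite mulr0.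
  case/negP: neq_lk; apply/eqP/val_inj => /=.
  by rewrite -(subKn le_kn) eq_sub subKn // -ltnS.
rewrite coefZ coefXn eqxx mulr1.
pose G i := 'C(n - i, k - i)%:R / 'C(n, k - i)%:R * p`_(n - i)
              * q`_(n - (k - i)).
rewrite (big_ord_widen n.+1 G) // [RHS]big_mkcond /=; apply: eq_bigr => i _.
case: ifPn => [le_ik | lt_ki].
  have lt_j : (k - i < n.+1)%N by rewrite ltnS (leq_trans (leq_subr _ _)).
  rewrite (big_pred1 (Ordinal lt_j)) // => j /=.
  by rewrite -val_eqE /= -[RHS](eqn_add2l i) subnKC.
rewrite big1 // => j /eqP eq_ijk; case/negP: lt_ki.
by rewrite ltnS -eq_ijk leq_addr.
Qed.

Lemma binomial_coef_additive_convolution (F : numFieldType) (n k : nat)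
    (p q : {poly F}) :
  (k <= n)%N ->
  binomial_coef n (additive_convolution n p q) k =
  \sum_(i < k.+1)
    'C(k, i)%:R * binomial_coef n p i * binomial_coef n q (k - i).
Proof.
move=> le_kn; rewrite /binomial_coef coef_additive_convolution // mulr_suml.
apply: eq_bigr => i _; have le_ik : (i <= k)%N by rewrite -ltnS.
have := @mul_bin_trinomial n i (k - i).
rewrite subnKC // => /(_ le_kn) /(congr1 (fun m => m%:R : F)).
rewrite !natrM => eq_bin.
have nz_k := bin_natr_neq0 F le_kn.
have nz_i := bin_natr_neq0 F (leq_trans le_ik le_kn).
have nz_ki := bin_natr_neq0 F (leq_trans (leq_subr i k) le_kn).
have -> : 'C(n - i, k - i)%:R = 'C(n, k)%:R * 'C(k, i)%:R / 'C(n, i)%:R :> F.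
  by rewrite -eq_bin mulfK.
by field; rewrite nz_k nz_i nz_ki.
Qed.

Lemma eq_binomial_coef (F : numFieldType) (n : nat) (p q : {poly F}) :
  (size p <= n.+1)%N -> (size q <= n.+1)%N ->
  (forall k, (k <= n)%N -> binomial_coef n p k = binomial_coef n q k) -> p = q.
Proof.
move=> szp szq eq_pq; apply/polyP => m.
have [le_mn | lt_nm] := leqP m n; last first.
  by rewrite !nth_default // (leq_trans _ lt_nm).
have := eq_pq (n - m)%N (leq_subr m n); rewrite /binomial_coef subKn //.
by move/divIf; apply; rewrite bin_natr_neq0 ?leq_subr.
Qed.

Lemma size_additive_convolution (F : fieldType) (n : nat) (p q : {poly F}) :
  (size (additive_convolution n p q) <= n.+1)%N.
Proof.
apply: (leq_trans (size_sum _ _ _)); apply/bigmax_leqP => k _.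
by rewrite (leq_trans (size_scale_leq _ _)) // size_polyXn ltnS leq_subr.
Qed.

Lemma binomial_coef_exp_XsubC (F : numFieldType) (n k : nat) (c : F) :
  (k <= n)%N -> binomial_coef n (('X - c%:P) ^+ n) k = (- c) ^+ k.
Proof.
move=> le_kn; rewrite /binomial_coef -polyCN addrC exprDn coef_sum.
have lt_m : (n - k < n.+1)%N by rewrite ltnS leq_subr.
rewrite (bigD1 (Ordinal lt_m)) //= [X in _ + X]big1 ?addr0; last first.
  move=> i neq_i; rewrite coefMn -rmorphXn coefCM coefXn.
  have -> : (n - k == i)%N = false.
    by apply/negP => /eqP eq_i; case/negP: neq_i; apply/eqP/val_inj.
  by rewrite mulr0 mul0rn.
rewrite coefMn -rmorphXn coefCM coefXn eqxx mulr1 subKn // bin_sub //.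
by rewrite -(mulr_natr (_ ^+ _)) mulfK // bin_natr_neq0.
Qed.

(** Homogeneity of the determinant, applied to c 'X - c A = c ('X - A). *)
Lemma char_poly_scale (F : fieldType) (n : nat) (c : F) (A : 'M[F]_n) :
  char_poly (c *: A) \Po (c *: 'X) = c ^+ n *: char_poly A.
Proof.
rewrite /char_poly -[RHS]mul_polyC polyC_exp -detZ -[LHS]det_map_mx; congr (\det _).
apply/matrixP => i j; rewrite !mxE rmorphB rmorphMn /= comp_polyX comp_polyC.
by rewrite mulrBr mulrnAr mul_polyC polyCM.
Qed.

Lemma coef_comp_scaleX (F : fieldType) (c : F) (p : {poly F}) (m : nat) :
  (p \Po (c *: 'X))`_m = c ^+ m * p`_m.
Proof.
rewrite coef_comp_poly; under eq_bigr do rewrite exprZn coefZ coefXn.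
have [lt_m | le_m] := ltnP m (size p); last first.
  rewrite nth_default // mulr0 big1 // => i _.
  by rewrite gtn_eqF ?mulr0 // (leq_trans (ltn_ord i)).
rewrite (bigD1 (Ordinal lt_m)) //= eqxx mulr1 mulrC big1 ?addr0 // => i neq_i.
by rewrite eq_sym (negPf (neq_i : val i != m)) !mulr0.
Qed.

Lemma binomial_coef_char_poly_scale (F : fieldType) (n k : nat) (c : F)
    (A : 'M[F]_n) :
  c != 0 -> (k <= n)%N ->
  binomial_coef n (char_poly (c *: A)) k =
  c ^+ k * binomial_coef n (char_poly A) k.
Proof.
move=> nz_c le_kn; rewrite /binomial_coef mulrA; congr (_ / _).
have nz_cnk : c ^+ (n - k) != 0 by rewrite expf_neq0.
apply: (mulfI nz_cnk); rewrite mulrA -exprD subnK //.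
by rewrite -coef_comp_scaleX char_poly_scale coefZ.
Qed.

Lemma sum_bin_natr (F : numFieldType) (k : nat) :
  \sum_(i < k.+1) 'C(k, i)%:R = 2 ^+ k :> F.
Proof.
rewrite -[2](natrD _ 1 1) exprDn; apply: eq_bigr => i _.
by rewrite !expr1n mulr1.
Qed.

(** The functional equation alpha(2 t) = alpha(t)^2 with alpha(0) = 1 has only
    exponentials as solutions. At index k the terms i = 0 and i = k of the square
    contribute 2 alpha_k and the others are known by induction, which leaves
    (2^k - 2) alpha_k = (2^k - 2) alpha_1^k. For k = 1 the equation is void, so
    alpha_1 is the free parameter. *)
Lemma geometric_of_binomial_square (F : numFieldType) (n : nat) (alpha : nat -> F) :
  alpha 0 = 1 ->
  (forall k, (k <= n)%N ->
     2 ^+ k * alpha k =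
     \sum_(i < k.+1) 'C(k, i)%:R * alpha i * alpha (k - i)%N) ->
  forall k, (k <= n)%N -> alpha k = alpha 1 ^+ k.
Proof.
move=> alpha0 sqr_alpha; elim/ltn_ind=> -[//|[//|k]] IHk le_kn.
have split_ends (f : nat -> F) :
    \sum_(i < k.+3) f i = f 0 + \sum_(i < k.+1) f i.+1 + f k.+2.
  by rewrite big_ord_recl big_ord_recr /= addrA.
have eq_alpha := sqr_alpha _ le_kn.
have eq_B := sum_bin_natr F k.+2.
rewrite (split_ends (fun i => 'C(k.+2, i)%:R)) bin0 binn in eq_B.
rewrite (split_ends (fun i => 'C(k.+2, i)%:R * alpha i * alpha (k.+2 - i)%N))
        bin0 binn subn0 subnn alpha0 in eq_alpha.
set B := \sum_(i < _) _ in eq_B; set sB := \sum_(i < _) _ in eq_alpha.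
have eq_sB : sB = B * alpha 1 ^+ k.+2.
  rewrite /sB /B mulr_suml; apply: eq_bigr => i _.
  have lt_ik : (i.+1 < k.+2)%N by rewrite ltnS.
  have lt_jk : (k.+2 - i.+1 < k.+2)%N by rewrite subSS ltnS leq_subr.
  have le_jn j : (j < k.+2)%N -> (j <= n)%N.
    by move=> lt_j; apply: leq_trans le_kn; apply: ltnW.
  rewrite (IHk _ lt_ik) ?(IHk _ lt_jk) ?le_jn //.
  by rewrite -mulrA -exprD subnKC // ltnW.
(* B, the sum of the inner binomial coefficients, is the factor 2^k - 2. *)
have def_B : B = 2 ^+ k.+2 - 2 by rewrite -eq_B; ring.
have nz_B : B != 0.
  rewrite def_B subr_eq0 -natrX Num.Theory.eqr_nat.
  by rewrite -[X in _ != X](expn1 2) eqn_exp2l.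
apply: (mulfI nz_B); rewrite -eq_sB def_B mulrBl eq_alpha; ring.
Qed.

(** 'X - c commutes with N, so N^m = 0 makes ('X - c) - N a factor of
    ('X - c)^m - N^m = ('X - c)^m; on determinants, the characteristic polynomial
    divides ('X - c)^(m n), and being monic of degree n it is ('X - c)^n. *)
Lemma char_poly_nilpotent_add_scalar (F : fieldType) (n : nat) (N : 'M[F]_n)
    (c : F) :
  nilpotent_mx N -> char_poly (N + c%:M) = ('X - c%:P) ^+ n.
Proof.
case=> m nilN; pose M := char_poly_mx (N + c%:M).
pose P : 'M[{poly F}]_n := map_mx polyC N.
have defM : M = ('X - c%:P)%:M - P.
  rewrite /M /char_poly_mx map_mxD map_scalar_mx raddfB /= opprD.
  by rewrite addrA addrAC.
have comm : GRing.comm (('X - c%:P)%:M : 'M_n) P by apply: comm_scalar_mx.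
have P0 : P ^+ m = 0 by rewrite /P -rmorphXn nilN rmorph0.
have := subrXX_comm m comm; rewrite P0 subr0 -defM => /(congr1 determinant).
rewrite -rmorphXn det_scalar det_mulmx -exprM => dvd_char.
have: char_poly (N + c%:M) %| ('X - c%:P) ^+ (m * n).
  by rewrite dvd_char dvdp_mulr.
case/dvdp_exp_XsubCP=> k _.
rewrite eqp_monic ?char_poly_monic ?monic_exp ?monicXsubC // => /eqP def_char.
have := size_char_poly (N + c%:M); rewrite def_char size_exp_XsubC => -[].
by move->.
Qed.

(** Cayley-Hamilton. The matrices of size 0 are treated apart because polynomials
    are evaluated only in nontrivial rings. *)
Lemma nilpotent_sub_scalar (F : fieldType) (n : nat) (A : 'M[F]_n) (c : F) :
  char_poly A = ('X - c%:P) ^+ n -> nilpotent_mx (A - c%:M).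
Proof.
case: n A => [|n] A char_A; first by exists 0; apply: thinmx0.
exists n.+1; rewrite -(Cayley_Hamilton A) char_A rmorphXn rmorphB /=.
by rewrite horner_mx_X horner_mx_C.
Qed.

Lemma nilpotent_scale (F : fieldType) (n : nat) (N : 'M[F]_n) (c : F) :
  nilpotent_mx N -> nilpotent_mx (c *: N).
Proof.
case: n N => [|n] N; first by exists 0; apply: thinmx0.
by case=> m N0; exists m; rewrite exprZn N0 scaler0.
Qed.

(** Comparing coordinates, free position of A with itself says that those of its
    characteristic polynomial satisfy alpha(2 t) = alpha(t)^2, as
    A + A = 2 A. *)
Lemma free_position_self_char_poly (F : numFieldType) (n : nat) (A : 'M[F]_n) :
  additive_finite_free_position A A <->
  exists c : F, char_poly A = ('X - c%:P) ^+ n.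
Proof.
have nz2 : 2 != 0 :> F by rewrite Num.Theory.pnatr_eq0.
have A2 : A + A = 2 *: A by rewrite scaler_nat mulr2n.
have szA : (size (char_poly A) <= n.+1)%N by rewrite size_char_poly.
rewrite /additive_finite_free_position A2; split=> [free_A | [c char_A]].
  pose alpha := binomial_coef n (char_poly A).
  have alpha0 : alpha 0 = 1.
    (* alpha_0 is the leading coefficient. *)
    rewrite /alpha /binomial_coef subn0 bin0 divr1.
    by have /monicP := char_poly_monic A; rewrite lead_coefE size_char_poly.
  exists (- alpha 1); apply: (eq_binomial_coef (n := n)) => // [|k le_kn].
    by rewrite size_exp_XsubC.
  rewrite binomial_coef_exp_XsubC // opprK.
  apply: (geometric_of_binomial_square (n := n)) => // l le_ln.
  by rewrite -binomial_coef_char_poly_scale // free_A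
             binomial_coef_additive_convolution.
apply: (eq_binomial_coef (n := n)); rewrite ?size_char_poly //.
  exact: size_additive_convolution.
move=> k le_kn; rewrite binomial_coef_char_poly_scale //.
rewrite binomial_coef_additive_convolution // char_A binomial_coef_exp_XsubC //.
rewrite -sum_bin_natr mulr_suml; apply: eq_bigr => i _.
have le_ik : (i <= k)%N by rewrite -ltnS.
rewrite !binomial_coef_exp_XsubC ?(leq_trans (leq_subr _ _)) //.
  by rewrite -mulrA -exprD subnKC.
exact: leq_trans le_kn.
Qed.

Lemma free_position_self (F : numFieldType) (n : nat) (A : 'M[F]_n) :
  additive_finite_free_position A A <->
  exists (N : 'M[F]_n) (c : F), nilpotent_mx N /\ A = N + c%:M.
Proof.
rewrite free_position_self_char_poly; split=> [[c char_A] | [N [c [nilN ->]]]].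
  by exists (A - c%:M), c; rewrite subrK; split=> //; apply: nilpotent_sub_scalar.
by exists c; apply: char_poly_nilpotent_add_scalar.
Qed.

Lemma nilpotent_add_scalar_unipotent (F : fieldType) (n : nat) (A : 'M[F]_n) :
  (exists (N : 'M[F]_n) (c : F), nilpotent_mx N /\ A = N + c%:M) <->
  (nilpotent_mx A \/
   exists (U : 'M[F]_n) (c : F), unipotent_mx U /\ A = c *: U).
Proof.
split=> [[N [c [nilN ->]]] | [nilA | [_ [c [[N nilN ->] ->]]]]].
(* N + c = c (1 + N / c) needs c <> 0; otherwise the matrix is N itself. *)
- have [-> | nz_c] := eqVneq c 0; first by left; rewrite raddf0 addr0.
  right; exists (1%:M + c^-1 *: N), c; split.
    by exists (c^-1 *: N) => //; apply: nilpotent_scale.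
  by rewrite scalerDr scalerA divff // scale1r scalemx1 addrC.
- by exists A, 0; rewrite raddf0 addr0.
exists (c *: N), c; split; first exact: nilpotent_scale.
by rewrite scalerDr scalemx1 addrC.
Qed.

(* The complex numbers are R[i] for R a model of the real numbers. A nonzero
   nilpotent matrix is the sum of a nilpotent and a scalar matrix (namely 0), but
   not a multiple of a unipotent matrix; hence the first disjunct in the last
   line. *)
Theorem theorem5p3 (R : realType) (n : nat) (A : 'M[R[i]]_n) :
  (additive_finite_free_position A A <->
     exists (N : 'M[R[i]]_n) (lambda : R[i]),
       nilpotent_mx N /\ A = N + lambda%:M) /\
  ((exists (N : 'M[R[i]]_n) (lambda : R[i]),
       nilpotent_mx N /\ A = N + lambda%:M) <->
     (nilpotent_mx A \/
      exists (U : 'M[R[i]]_n) (c : R[i]), unipotent_mx U /\ A = c *: U)).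
Proof.
split; first exact: free_position_self.
exact: nilpotent_add_scalar_unipotent.
Qed.
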